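(* Let $f\in\mathcal{A}$, and let $\beta,\gamma$ be real numbers with $\beta+2\gamma\geq 0$. If either $$\left|\frac{zf'(z)}{f(z)}-1\right|^{\beta}\left|z\left(\frac{zf'(z)}{f(z)}\right)'\right|^{\gamma}<\left(\frac{1}{2}\right)^{\gamma}\qquad\text{for all } z\in\mathbb{U},$$ or $$\left|\frac{zf'(z)}{f(z)}+1\right|^{\beta}\left|z\left(\frac{zf'(z)}{f(z)}\right)'\right|^{\gamma}<\left(\frac{1}{2}\right)^{\gamma}\qquad\text{for all } z\in\mathbb{U},$$ then $f\in\mathcal{S}^{*}$, i.e. $\mathrm{Re}\left(\frac{zf'(z)}{f(z)}\right)>0$ for all $z\in\mathbb{U}$.
   Context: $\mathbb{U}=\{z\in\mathbb{C}:|z|<1\}$ is the open unit disk. $\mathcal{A}$ is the class of functions $f$ analytic in $\mathbb{U}$ with $f(0)=0$ and $f'(0)=1$. The function $\frac{zf'(z)}{f(z)}$ has a removable singularity at $z=0$, where it takes the value $1$. $\mathcal{S}^{*}=\{f\in\mathcal{A}:\mathrm{Re}(zf'(z)/f(z))>0 \text{ for all } z\in\mathbb{U}\}$. The prime in $\left(\frac{zf'(z)}{f(z)}\right)'$ denotes differentiation with respect to $z$.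
   Formalization: For γ<0 the power 0^γ at z=0 is undefined, and is taken to violate the inequality, so the result has content only for γ≥0; with the limit at z=0 the first alternative is false for γ<0. For β<0 nothing is required where the first factor is 0. *)

(* Defs.v *)
(* Stdlib reals with Coquelicot: the complex plane is Coquelicot's [C]. *)
From Stdlib Require Export Reals.
From Coquelicot Require Export Coquelicot.

Local Open Scope C_scope.

Definition unit_disk (z : C) : Prop := (Cmod z < 1)%R.

(* Analytic: near each point of [D], the sum of a power series. *)
Definition analytic_on (D : C -> Prop) (f : C -> C) : Prop :=
  forall z0 : C, D z0 ->
    exists (r : R) (a : nat -> C), (0 < r)%R /\
      forall z : C, (Cmod (z - z0) < r)%R ->
        @is_pseries C_AbsRing C_NormedModule a (z - z0) (f z).

Definition class_A (f : C -> C) : Prop :=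
  analytic_on unit_disk f /\ f 0 = 0 /\ C_derive f 0 = 1.

(* z f'(z) / f(z), with the removable singularity at the origin filled in. *)
Definition zdlog (f : C -> C) (z : C) : C :=
  if Ceq_dec z 0 then 1 else z * C_derive f z / f z.

(* Since [/ 0 = 0] in [C], the inequality also forces f(z) <> 0 for z <> 0. *)
Definition starlike (f : C -> C) : Prop :=
  class_A f /\ forall z : C, unit_disk z -> (0 < Re (zdlog f z))%R.

(* x^a for x >= 0, with 0^0 = 1 and 0^a = 0 for a > 0 (Stdlib's
   [Rpower 0 a] is 1 for every a).  The value 0 also given to 0^a for a < 0 is
   never used in [pow_bound]. *)
Definition rpow (x a : R) : R :=
  if Req_dec_T x 0 then (if Req_dec_T a 0 then 1%R else 0%R)
  else Rpower x a.

(* A^beta * B^gamma < (1/2)^gamma for A, B >= 0, a negative power of 0 being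
   treated as follows.
   - gamma < 0 and B = 0: B^gamma is infinite and the bound fails.
   - beta < 0 and A = 0: the product has no literal value and nothing is
     required.  With A = |z f'/f - 1| this always happens at the origin, where
     B = 0 too; a literal reading would then admit no f at all for beta < 0.
   The two cases cannot be treated alike: ignoring the origin (or taking the
   limit there) when gamma < 0 < beta would admit f(z) = z exp (3 z^2 / 2) for
   beta = 2, gamma = -1, where z f'/f = 1 + 3 z^2 and the product is
   3 |z|^2 / 2 < 2, although f is not starlike. *)
Definition pow_bound (A B beta gamma : R) : Prop :=
  (gamma < 0 -> B <> 0)%R /\
  ((beta < 0 -> A <> 0)%R ->
   (rpow A beta * rpow B gamma < Rpower (1 / 2) gamma)%R).

(* Main.v *)
Require Import Defs.
From Stdlib Require Import Lra Lia Classical ClassicalEpsilon.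

Local Open Scope C_scope.

(* Put p = z f'/f, so that p(0) = 1. The bound at z = 0 forces gamma >= 0. If f
   is not starlike, let r < 1 be the largest radius with Re p > 0 on |z| < r.
   As |f| increases along rays there, f has no zero on |z| = r, and Re p
   vanishes at some z0 with |z0| = r. The Schwarz lemma for (p - 1)/(p + 1) on
   |z| < r gives |z0 p'(z0)| >= (1 + y^2)/2 with p(z0) = iy, while
   |p(z0) - 1|^2 = |p(z0) + 1|^2 = 1 + y^2. Hence at z0 either product is at
   least (1 + y^2)^(beta/2 + gamma) / 2^gamma >= (1/2)^gamma. *)

(** * Taylor expansions of finite order *)

(** As p is a quotient of power series, analyticity is used only through expansions of finite order:
    these pass to products and quotients by short algebra, while a convergent series for p would
    call for estimates on reciprocal series. Order 2 suffices for derivatives along rays and order 3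
    for the maximum modulus principle; estimates on series are confined to one Lipschitz bound.

    The constant 1/2 has its origin in w = (p - 1)/(p + 1): from w(0) = 0 and |w| maximal at z0 with
    value 1, Schwarz gives Re (z0 w'(z0) / w(z0)) >= 1, and this quotient equals 2 z0 p'(z0) /
    (p(z0)^2 - 1) = - 2 z0 p'(z0) / (1 + y^2).

    The hypothesis says nothing at a zero of f off the origin, and there [zdlog] has the default
    value 0, which also breaks positivity. The first bad radius might thus be that of a zero, so
    nonvanishing has to be settled before p is even known to be continuous on that circle. *)

Definition near (z0 : C) (P : C -> Prop) : Prop :=
  exists d : R, (0 < d)%R /\ forall z, (Cmod (z - z0) < d)%R -> P z.

Lemma near_imp (z0 : C) (P Q : C -> Prop) :
  (forall z, P z -> Q z) -> near z0 P -> near z0 Q.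
Proof. intros H [d [hd hP]]. exists d; split; auto. Qed.

Lemma near_and (z0 : C) (P Q : C -> Prop) :
  near z0 P -> near z0 Q -> near z0 (fun z => P z /\ Q z).
Proof.
  intros [d [hd hP]] [e [he hQ]]. exists (Rmin d e). split.
  - apply Rmin_pos; assumption.
  - intros z hz. split.
    + apply hP. apply Rlt_le_trans with (1 := hz), Rmin_l.
    + apply hQ. apply Rlt_le_trans with (1 := hz), Rmin_r.
Qed.

Lemma near_self (z0 : C) (P : C -> Prop) : near z0 P -> P z0.
Proof.
  intros [d [hd hP]]. apply hP. replace (z0 - z0) with (RtoC 0) by ring.
  rewrite Cmod_0. exact hd.
Qed.

Lemma near_near (z0 : C) (P : C -> Prop) :
  near z0 P -> near z0 (fun z => near z P).
Proof.
  intros [d [hd hP]]. exists d; split; [exact hd|]. intros z hz.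
  exists (d - Cmod (z - z0))%R; split; [lra|]. intros x hx. apply hP.
  replace (x - z0) with ((x - z) + (z - z0)) by ring.
  apply Rle_lt_trans with (1 := Cmod_triangle _ _). lra.
Qed.

Lemma near_ball (z0 : C) (r : R) :
  (0 < r)%R -> near z0 (fun z => (Cmod (z - z0) < r)%R).
Proof. intros hr. exists r; split; auto. Qed.

Lemma near_neq (z0 w : C) : z0 <> w -> near z0 (fun z => z <> w).
Proof.
  intros hw. exists (Cmod (z0 - w)); split.
  - apply Cmod_gt_0. intros e. apply hw.
    replace z0 with ((z0 - w) + w) by ring. rewrite e. ring.
  - intros z hz e. subst z. replace (w - z0) with (- (z0 - w)) in hz by ring.
    rewrite Cmod_opp in hz. lra.
Qed.

(* [h] has a Taylor expansion at [z0] up to a remainder [O((z - z0)^n)]. *)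
Fixpoint taylor (n : nat) (h : C -> C) (z0 : C) : Prop :=
  match n with
  | O => exists M : R, near z0 (fun z => (Cmod (h z) <= M)%R)
  | S n => exists g : C -> C,
      taylor n g z0 /\ near z0 (fun z => h z = h z0 + (z - z0) * g z)
  end.

Lemma taylor_ext (n : nat) (h k : C -> C) (z0 : C) :
  near z0 (fun z => h z = k z) -> taylor n h z0 -> taylor n k z0.
Proof.
  intros e. destruct n as [|n].
  - intros [M hM]. exists M. generalize (near_and _ _ _ e hM).
    apply near_imp. intros z [ez hz]. rewrite <- ez. exact hz.
  - intros [g [hg hh]]. exists g; split; [exact hg|].
    generalize (near_and _ _ _ e hh). apply near_imp. intros z [ez hz].
    rewrite <- ez, <- (near_self _ _ e). exact hz.
Qed.

Lemma taylor_const (n : nat) (c z0 : C) : taylor n (fun _ => c) z0.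
Proof.
  revert c. induction n as [|n IH]; intros c.
  - exists (Cmod c), 1%R. split; [lra|]. intros; lra.
  - exists (fun _ => 0); split; [apply IH|].
    exists 1%R. split; [lra|]. intros; ring.
Qed.

Lemma taylor_id (n : nat) (z0 : C) : taylor n (fun z => z) z0.
Proof.
  destruct n as [|n].
  - exists (Cmod z0 + 1)%R, 1%R. split; [lra|]. intros z hz.
    replace z with (z0 + (z - z0)) by ring.
    apply Rle_trans with (1 := Cmod_triangle _ _). lra.
  - exists (fun _ => 1); split; [apply taylor_const|].
    exists 1%R. split; [lra|]. intros; ring.
Qed.

Lemma taylor_plus (n : nat) (h k : C -> C) (z0 : C) :
  taylor n h z0 -> taylor n k z0 -> taylor n (fun z => h z + k z) z0.
Proof.
  revert h k. induction n as [|n IH]; intros h k.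
  - intros [M hM] [N hN]. exists (M + N)%R.
    generalize (near_and _ _ _ hM hN). apply near_imp. intros z [hz kz].
    apply Rle_trans with (1 := Cmod_triangle _ _). lra.
  - intros [g [hg eh]] [l [hl ek]]. exists (fun z => g z + l z).
    split; [auto|]. generalize (near_and _ _ _ eh ek). apply near_imp.
    intros z [hz kz]. rewrite hz, kz. ring.
Qed.

Lemma taylor_0_mult (h k : C -> C) (z0 : C) :
  taylor 0 h z0 -> taylor 0 k z0 -> taylor 0 (fun z => h z * k z) z0.
Proof.
  intros [M hM] [N hN]. exists (M * N)%R.
  generalize (near_and _ _ _ hM hN). apply near_imp. intros z [hz kz].
  rewrite Cmod_mult. apply Rmult_le_compat; auto using Cmod_ge_0.
Qed.

Lemma taylor_pred (n : nat) (h : C -> C) (z0 : C) :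
  taylor (S n) h z0 -> taylor n h z0.
Proof.
  revert h. induction n as [|n IH]; intros h [g [hg eh]].
  - apply (taylor_ext 0 (fun z => h z0 + (z + (- z0)) * g z)).
    + generalize eh. apply near_imp. intros z ->. reflexivity.
    + apply (taylor_plus 0); [apply taylor_const|].
      apply taylor_0_mult; [|exact hg].
      apply (taylor_plus 0); [apply taylor_id|apply taylor_const].
  - exists g. split; [apply IH; exact hg|exact eh].
Qed.

Lemma taylor_le (m n : nat) (h : C -> C) (z0 : C) :
  (m <= n)%nat -> taylor n h z0 -> taylor m h z0.
Proof. induction 1; auto using taylor_pred. Qed.

Lemma taylor_mult (n : nat) (h k : C -> C) (z0 : C) :
  taylor n h z0 -> taylor n k z0 -> taylor n (fun z => h z * k z) z0.
Proof.
  revert h k. induction n as [|n IH]; intros h k hh hk.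
  - apply taylor_0_mult; assumption.
  - pose proof (taylor_pred _ _ _ hk) as hk'.
    destruct hh as [g [hg eh]]. destruct hk as [l [hl ek]].
    (* This splits h k - h(z0) k(z0) as h(z0) (k - k(z0)) + (h - h(z0)) k; since [k] itself appears
       in the new factor, its expansion is also needed at the lower order. *)
    exists (fun z => h z0 * l z + g z * k z). split.
    + apply taylor_plus; apply IH; auto. apply taylor_const.
    + generalize (near_and _ _ _ eh ek). apply near_imp.
      intros z [hz kz]. rewrite hz, kz. ring.
Qed.

Lemma taylor_minus (n : nat) (h k : C -> C) (z0 : C) :
  taylor n h z0 -> taylor n k z0 -> taylor n (fun z => h z - k z) z0.
Proof.
  intros hh hk. apply (taylor_ext n (fun z => h z + (- (1)) * k z)).
  - exists 1%R. split; [lra|]. intros; ring.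
  - apply taylor_plus; [exact hh|].
    apply taylor_mult; [apply taylor_const|exact hk].
Qed.

Lemma taylor_1_continuous (h : C -> C) (z0 : C) (e : R) :
  taylor 1 h z0 -> (0 < e)%R -> near z0 (fun z => (Cmod (h z - h z0) < e)%R).
Proof.
  intros [g [[M hM] eh]] he.
  assert (hd : (0 < e / (Rabs M + 1))%R).
  { pose proof (Rabs_pos M). apply Rdiv_lt_0_compat; lra. }
  generalize (near_and _ _ _ (near_and _ _ _ hM eh) (near_ball z0 _ hd)).
  apply near_imp. intros z [[gz hz] bz]. rewrite hz.
  replace (h z0 + (z - z0) * g z - h z0) with ((z - z0) * g z) by ring.
  rewrite Cmod_mult. pose proof (Rabs_pos M). pose proof (Rle_abs M).
  replace e with ((e / (Rabs M + 1)) * (Rabs M + 1))%R by (field; lra).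
  pose proof (Cmod_ge_0 (z - z0)). pose proof (Cmod_ge_0 (g z)). nra.
Qed.

Lemma taylor_1_nonzero (h : C -> C) (z0 : C) :
  taylor 1 h z0 -> h z0 <> 0 -> near z0 (fun z => h z <> 0).
Proof.
  intros hh h0. apply Cmod_gt_0 in h0.
  generalize (taylor_1_continuous _ _ _ hh h0). apply near_imp.
  intros z hz e. rewrite e in hz. replace (0 - h z0) with (- h z0) in hz by ring.
  rewrite Cmod_opp in hz. lra.
Qed.

(** The identity 1/h - 1/h(z0) = - (z - z0) g / (h(z0) h) expresses the new factor by [/ h] at one
    order less, and the induction ends at the boundedness of [/ h]. Order 0 is excluded because
    boundedness of [h] does not keep it away from 0. *)
Lemma taylor_inv (n : nat) (h : C -> C) (z0 : C) :
  taylor (S n) h z0 -> h z0 <> 0 -> taylor (S n) (fun z => / h z) z0.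
Proof.
  intros hh h0.
  assert (hn : near z0 (fun z => h z <> 0)).
  { apply taylor_1_nonzero; [|exact h0]. apply (taylor_le _ (S n)); [lia|exact hh]. }
  assert (b : taylor 0 (fun z => / h z) z0).
  { exists (/ (Cmod (h z0) / 2))%R.
    assert (hp : (0 < Cmod (h z0))%R) by (apply Cmod_gt_0; exact h0).
    assert (h1 : taylor 1 h z0) by (apply (taylor_le _ (S n)); [lia|exact hh]).
    generalize (near_and _ _ _ hn (taylor_1_continuous _ _ (Cmod (h z0) / 2) h1 ltac:(lra))).
    apply near_imp. intros z [nz hz]. rewrite Cmod_inv by exact nz.
    apply Rinv_le_contravar; [lra|].
    replace (h z - h z0) with (- (h z0 - h z)) in hz by ring.
    rewrite Cmod_opp in hz.
    pose proof (Cmod_triangle (h z0 - h z) (h z)) as t.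
    replace (h z0 - h z + h z) with (h z0) in t by ring. lra. }
  revert hh. induction n as [|n IH]; intros [g [hg eh]].
  - exists (fun z => (- / h z0) * (g z * / h z)). split.
    + apply taylor_mult; [apply taylor_const|]. apply taylor_mult; assumption.
    + generalize (near_and _ _ _ hn eh). apply near_imp. intros z [nz hz].
      replace (/ h z) with
        (/ h z0 + - / h z0 * ((h z0 + (z - z0) * g z - h z0) * / h z)) at 1.
      * ring.
      * rewrite <- hz. field. auto.
  - exists (fun z => (- / h z0) * (g z * / h z)). split.
    + apply taylor_mult; [apply taylor_const|]. apply taylor_mult; [exact hg|].
      apply IH. apply taylor_pred. exists g. split; assumption.
    + generalize (near_and _ _ _ hn eh). apply near_imp. intros z [nz hz].
      replace (/ h z) with
        (/ h z0 + - / h z0 * ((h z0 + (z - z0) * g z - h z0) * / h z)) at 1.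
      * ring.
      * rewrite <- hz. field. auto.
Qed.

Lemma taylor_div (n : nat) (h k : C -> C) (z0 : C) :
  taylor (S n) h z0 -> taylor (S n) k z0 -> k z0 <> 0 ->
  taylor (S n) (fun z => h z / k z) z0.
Proof.
  intros hh hk k0. unfold Cdiv. apply taylor_mult; [exact hh|].
  apply taylor_inv; assumption.
Qed.

(** * Complex derivatives and divided differences *)

Lemma sqrt_2_lt_2 : (sqrt 2 < 2)%R.
Proof.
  rewrite <- (sqrt_Rsqr 2) at 2 by lra. apply sqrt_lt_1; unfold Rsqr; lra.
Qed.

Lemma C_derive_unique (h g : C -> C) (z0 : C) :
  taylor 1 g z0 -> near z0 (fun z => h z = h z0 + (z - z0) * g z) ->
  C_derive h z0 = g z0.
Proof.
  intros hg eh. unfold C_derive. apply is_C_lim_unique.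
  intros P [e he].
  destruct (near_and _ _ _ eh (taylor_1_continuous _ _ e hg (cond_pos e)))
    as [d [hd hz]].
  (* The balls of the uniform structure on [C] are squares: one of radius d/2 lies in the disk of
     radius sqrt 2 * d/2 < d. *)
  assert (hd2 : (0 < d / 2)%R) by lra.
  exists (mkposreal _ hd2). intros z bz nz. apply he.
  assert (cz : (Cmod (z - z0) < d)%R).
  { apply C_NormedModule_mixin_compat2 in bz. simpl in bz.
    pose proof sqrt_2_lt_2.
    assert (b : (Cmod (z - z0) < sqrt 2 * (d / 2))%R) by exact bz. nra. }
  destruct (hz z cz) as [ez gz].
  replace ((h z - h z0) / (z - z0)) with (g z).
  - apply C_NormedModule_mixin_compat1. exact gz.
  - change (g z = (h z - h z0) / (z - z0)). rewrite ez. field. intros e'. apply nz.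
    change (z = z0 :> C).
    replace z with ((z - z0) + z0) by ring. rewrite e'. ring.
Qed.

Definition slope (h : C -> C) (z0 z : C) : C :=
  if Ceq_dec z z0 then C_derive h z0 else (h z - h z0) / (z - z0).

Lemma slope_eq (h : C -> C) (z0 z : C) :
  h z = h z0 + (z - z0) * slope h z0 z.
Proof.
  unfold slope. destruct (Ceq_dec z z0) as [->|n].
  - ring.
  - field. intros e. apply n. replace z with ((z - z0) + z0) by ring.
    rewrite e. ring.
Qed.

(** The factor [g] of the expansion agrees with the slope near [z0], at [z0] itself because [g] is
    continuous there; this continuity is why the order starts at 2. *)
Lemma taylor_slope (n : nat) (h : C -> C) (z0 : C) :
  taylor (S (S n)) h z0 -> taylor (S n) (slope h z0) z0.
Proof.
  intros [g [hg eh]]. apply (taylor_ext _ g); [|exact hg].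
  generalize eh. apply near_imp. intros z hz. unfold slope.
  destruct (Ceq_dec z z0) as [->|nz].
  - symmetry. apply C_derive_unique; [|exact eh].
    apply (taylor_le _ (S n)); [lia|exact hg].
  - rewrite hz. field. intros e. apply nz.
    replace z with ((z - z0) + z0) by ring. rewrite e. ring.
Qed.

(** * Power series *)

Lemma series_near (c : nat -> C) (l : C) (e : R) :
  @is_series C_AbsRing C_NormedModule c l -> (0 < e)%R ->
  exists N, forall n, (N <= n)%nat ->
    (Cmod (@sum_n C_AbelianMonoid c n - l) < e)%R.
Proof.
  intros hc he.
  exact (proj1 (filterlim_locally_ball_norm (U := C_NormedModule) _ _) hc
    (mkposreal e he)).
Qed.

Lemma series_bound (c : nat -> C) (l : C) (K : R) :
  @is_series C_AbsRing C_NormedModule c l ->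
  (forall n, (Cmod (c n) <= K * (1 / 2) ^ n)%R) -> (Cmod l <= 2 * K)%R.
Proof.
  intros hc hK. apply Rnot_lt_le. intros hl.
  assert (hs : forall n,
    (Cmod (@sum_n C_AbelianMonoid c n) <= 2 * K - K * (1 / 2) ^ n)%R).
  (* The partial sums of K / 2^k up to k = n add up to 2 K - K / 2^n, so the excess of |l| over 2 K
     would persist in the limit. *)
  { induction n as [|n IH].
    - rewrite sum_O. specialize (hK O). simpl in *. lra.
    - rewrite sum_Sn. specialize (hK (S n)). simpl in hK.
      change (Cmod (@sum_n C_AbelianMonoid c n + c (S n))
        <= 2 * K - K * (1 / 2) ^ S n)%R.
      apply Rle_trans with (1 := Cmod_triangle _ _). simpl. lra. }
  assert (hK0 : (0 <= K)%R).
  { specialize (hK O). simpl in hK. pose proof (Cmod_ge_0 (c O)). lra. }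
  destruct (series_near c l (Cmod l - 2 * K) hc ltac:(lra)) as [N hN].
  specialize (hN N (le_n N)). specialize (hs N).
  set (s := @sum_n C_AbelianMonoid c N) in *.
  pose proof (Cmod_triangle (- (s - l)) s) as t. rewrite Cmod_opp in t.
  replace (- (s - l) + s) with l in t by ring.
  assert (0 <= K * (1 / 2) ^ N)%R.
  { apply Rmult_le_pos; [lra|]. apply pow_le; lra. }
  lra.
Qed.

Lemma bounded_of_eventually_bounded (u : nat -> R) (M : R) (N : nat) :
  (forall n, (N <= n)%nat -> (u n <= M)%R) ->
  exists K : R, forall n, (u n <= K)%R.
Proof.
  revert M. induction N as [|N IH]; intros M h.
  - exists M. intros n. apply h. lia.
  - apply (IH (Rmax M (u N))). intros n hn.
    destruct (Nat.eq_dec n N) as [->|ne]; [apply Rmax_r|].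
    apply Rle_trans with (2 := Rmax_l _ _). apply h. lia.
Qed.

Lemma series_terms_bounded (c : nat -> C) (l : C) :
  @is_series C_AbsRing C_NormedModule c l ->
  exists K : R, forall n, (Cmod (c n) <= K)%R.
Proof.
  intros hc. destruct (series_near c l 1 hc ltac:(lra)) as [N hN].
  apply (bounded_of_eventually_bounded _ 2 (S N)). intros [|n] hn; [lia|].
  pose proof (hN n ltac:(lia)) as h1. pose proof (hN (S n) ltac:(lia)) as h2.
  rewrite sum_Sn in h2.
  change (Cmod (@sum_n C_AbelianMonoid c n + c (S n) - l) < 1)%R in h2.
  set (s := @sum_n C_AbelianMonoid c n) in *.
  pose proof (Cmod_triangle (s + c (S n) - l) (- (s - l))) as t.
  rewrite Cmod_opp in t.
  replace (s + c (S n) - l + - (s - l)) with (c (S n)) in t by ring. lra.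
Qed.

Definition has_pseries (a : nat -> C) (h : C -> C) (z0 : C) : Prop :=
  near z0 (fun z => @is_pseries C_AbsRing C_NormedModule a (z - z0) (h z)).

Lemma pow_n_Cpow (z : C) (n : nat) : @pow_n C_Ring z n = Cpow z n.
Proof. induction n as [|n IH]; [reflexivity|]. simpl. rewrite <- IH. reflexivity. Qed.

Lemma pseries_Cpow (a : nat -> C) (u l : C) :
  @is_pseries C_AbsRing C_NormedModule a u l ->
  @is_series C_AbsRing C_NormedModule (fun n => Cpow u n * a n) l.
Proof.
  apply is_series_ext. intros n. rewrite <- pow_n_Cpow. reflexivity.
Qed.

Lemma near_point (z0 : C) (P : C -> Prop) :
  near z0 P -> exists z, z <> z0 /\ P z.
Proof.
  intros [d [hd hP]]. exists (z0 + RtoC (d / 2)). split.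
  - intros e. assert (e' : RtoC (d / 2) = RtoC 0).
    { replace (RtoC (d / 2)) with ((z0 + RtoC (d / 2)) - z0) by ring.
      rewrite e. ring. }
    apply RtoC_inj in e'. lra.
  - apply hP. replace (z0 + RtoC (d / 2) - z0) with (RtoC (d / 2)) by ring.
    rewrite Cmod_R, Rabs_pos_eq; lra.
Qed.

Lemma Cminus_neq_0 (z w : C) : z <> w -> z - w <> 0.
Proof.
  intros n e. apply n. replace z with ((z - w) + w) by ring. rewrite e. ring.
Qed.

(** Convergence at a single point off the centre bounds the terms there, and [r] is the distance of
    that point from [z0]. *)
Lemma has_pseries_coef_bound (a : nat -> C) (h : C -> C) (z0 : C) :
  has_pseries a h z0 ->
  exists r K : R, (0 < r)%R /\ forall n, (Cmod (a n) * r ^ n <= K)%R.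
Proof.
  intros ha. destruct (near_point _ _ ha) as [z [nz hz]].
  destruct (series_terms_bounded _ _ (pseries_Cpow _ _ _ hz)) as [K hK].
  exists (Cmod (z - z0)), K. split.
  - apply Cmod_gt_0, Cminus_neq_0, nz.
  - intros n. specialize (hK n). rewrite Cmod_mult, Cmod_pow in hK. lra.
Qed.

Lemma has_pseries_0 (a : nat -> C) (h : C -> C) (z0 : C) :
  has_pseries a h z0 -> h z0 = a O.
Proof.
  intros ha. pose proof (near_self _ _ ha) as h0. simpl in h0.
  replace (z0 - z0) with (RtoC 0) in h0 by ring.
  apply (filterlim_locally_unique (V := C_NormedModule) _ _ _ h0).
  apply (is_pseries_0 (K := C_AbsRing) (V := C_NormedModule)).
Qed.

Lemma has_pseries_tail (a : nat -> C) (h : C -> C) (z0 : C) :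
  has_pseries a h z0 ->
  exists g, has_pseries (fun n => a (S n)) g z0 /\
    near z0 (fun z => h z = h z0 + (z - z0) * g z).
Proof.
  intros ha.
  exists (fun z => if Ceq_dec z z0 then a 1%nat else (h z - h z0) / (z - z0)).
  split.
  - generalize ha. apply near_imp. intros z hz.
    destruct (Ceq_dec z z0) as [->|nz].
    + replace (z0 - z0) with (RtoC 0) by ring.
      apply (is_pseries_0 (K := C_AbsRing) (V := C_NormedModule)
               (fun n => a (S n))).
    + apply (is_pseries_decr_1 (K := C_AbsRing) (V := C_NormedModule)
               a _ (/ (z - z0))) in hz.
      * rewrite (has_pseries_0 _ _ _ ha).
        replace ((h z - a O) / (z - z0)) with (/ (z - z0) * (h z - a O)).
        exact hz. unfold Cdiv. ring.
      * apply Cinv_l. apply Cminus_neq_0, nz.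
  - exists 1%R; split; [lra|]. intros z _.
    destruct (Ceq_dec z z0) as [->|nz]; [ring|].
    field. apply Cminus_neq_0, nz.
Qed.

(** A termwise bound on u^n - v^n, summed against a geometric series. The constant is uniform in
    both points, so that it bounds not only [h] but also its derivative at every nearby point. *)
Lemma has_pseries_lipschitz (a : nat -> C) (h : C -> C) (z0 : C) :
  has_pseries a h z0 ->
  exists M d : R, (0 < d)%R /\ forall z w : C,
    (Cmod (z - z0) < d)%R -> (Cmod (w - z0) < d)%R ->
    (Cmod (h z - h w) <= M * Cmod (z - w))%R.
Proof.
  intros ha. destruct (has_pseries_coef_bound _ _ _ ha) as [r [K [hr hK]]].
  destruct ha as [d [hd ha]].
  (* With s = r/4 the factor 2^n s^n equals r^n / 2^n: one half of the radius is spent on the crude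
     bound 2^n in place of n, the other on geometric decay. *)
  set (s := (r / 4)%R). assert (hs : (0 < s)%R) by (unfold s; lra).
  exists (2 * K / s)%R, (Rmin d s).
  split; [apply Rmin_pos; assumption|]. intros z w hz hw.
  pose proof (Rmin_l d s). pose proof (Rmin_r d s).
  assert (hc := is_series_minus _ _ _ _
    (pseries_Cpow _ _ _ (ha z ltac:(lra)))
    (pseries_Cpow _ _ _ (ha w ltac:(lra)))).
  set (u := z - z0) in *. set (v := w - z0) in *.
  replace (z - w) with (u - v) by (unfold u, v; ring).
  (* The usual factor n s^(n-1) is weakened to 2^n s^(n-1), and both sides are multiplied by [s] to
     avoid the exponent n - 1. *)
  assert (hp : forall n,
    (s * Cmod (Cpow u n - Cpow v n) <= 2 ^ n * s ^ n * Cmod (u - v))%R).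
  { induction n as [|n IH].
    - simpl. replace (RtoC 1 - RtoC 1) with (RtoC 0) by ring. rewrite Cmod_0.
      pose proof (Cmod_ge_0 (u - v)). nra.
    - simpl. replace (u * u ^ n - v * v ^ n)%C
        with (u * (u ^ n - v ^ n) + (u - v) * v ^ n) by ring.
      pose proof (Cmod_triangle (u * (u ^ n - v ^ n)) ((u - v) * v ^ n)) as t.
      rewrite !Cmod_mult, Cmod_pow in t.
      assert (hv : (Cmod v ^ n <= s ^ n)%R).
      { apply pow_incr. split; [apply Cmod_ge_0|lra]. }
      assert (h1 : (1 <= 2 ^ n)%R) by (apply pow_R1_Rle; lra).
      pose proof (Cmod_ge_0 (u - v)). pose proof (Cmod_ge_0 (u ^ n - v ^ n)).
      pose proof (Cmod_ge_0 u).
      assert (hsn : (0 <= s ^ n)%R) by (apply pow_le; lra).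
      assert (q1 : (Cmod u * Cmod (u ^ n - v ^ n)
               <= s * Cmod (u ^ n - v ^ n))%R) by (apply Rmult_le_compat_r; lra).
      assert (q2 : (Cmod (u - v) * Cmod v ^ n <= Cmod (u - v) * s ^ n)%R)
        by (apply Rmult_le_compat_l; lra).
      assert (q3 : (1 * (s ^ n * Cmod (u - v)) <= 2 ^ n * (s ^ n * Cmod (u - v)))%R)
        by (apply Rmult_le_compat_r; [apply Rmult_le_pos|]; lra).
      apply Rle_trans with (s * (2 * (2 ^ n * s ^ n * Cmod (u - v))))%R.
      2: right; ring.
      apply Rmult_le_compat_l; lra. }
  assert (hb := series_bound _ _ (K / s * Cmod (u - v)) hc).
  replace (2 * K / s * Cmod (u - v))%R with (2 * (K / s * Cmod (u - v)))%R
    by (field; lra).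
  apply hb. intros n. change (Cmod (u ^ n * a n - v ^ n * a n)
    <= K / s * Cmod (u - v) * (1 / 2) ^ n)%R.
  replace (u ^ n * a n - v ^ n * a n) with ((u ^ n - v ^ n) * a n) by ring.
  rewrite Cmod_mult. specialize (hp n). specialize (hK n).
  apply Rmult_le_reg_l with (1 := hs).
  replace (s * (K / s * Cmod (u - v) * (1 / 2) ^ n))%R
    with (K * Cmod (u - v) * (1 / 2) ^ n)%R by (field; lra).
  apply Rle_trans with (2 ^ n * s ^ n * Cmod (u - v) * Cmod (a n))%R.
  { rewrite <- Rmult_assoc. apply Rmult_le_compat_r; [apply Cmod_ge_0|exact hp]. }
  replace (2 ^ n * s ^ n * Cmod (u - v) * Cmod (a n))%R
    with (Cmod (a n) * r ^ n * Cmod (u - v) * (1 / 2) ^ n)%R.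
  - apply Rmult_le_compat_r; [apply pow_le; lra|].
    apply Rmult_le_compat_r; [apply Cmod_ge_0|exact hK].
  - rewrite <- Rpow_mult_distr. unfold s.
    replace (2 * (r / 4))%R with (r * (1 / 2))%R by field.
    rewrite Rpow_mult_distr. ring.
Qed.

Lemma has_pseries_taylor (n : nat) (a : nat -> C) (h : C -> C) (z0 : C) :
  has_pseries a h z0 -> taylor n h z0.
Proof.
  revert a h. induction n as [|n IH]; intros a h ha.
  - destruct (has_pseries_lipschitz _ _ _ ha) as [M [d [hd hl]]].
    exists (Cmod (h z0) + Rabs M * d)%R, d. split; [exact hd|]. intros z hz.
    assert (h0 : (Cmod (z0 - z0) < d)%R).
    { replace (z0 - z0) with (RtoC 0) by ring. rewrite Cmod_0. exact hd. }
    specialize (hl z z0 hz h0).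
    pose proof (Cmod_triangle (h z0) (h z - h z0)) as t.
    replace (h z0 + (h z - h z0)) with (h z) in t by ring.
    pose proof (Rle_abs M). pose proof (Rabs_pos M).
    pose proof (Cmod_ge_0 (z - z0)). nra.
  - destruct (has_pseries_tail _ _ _ ha) as [g [hg eh]].
    exists g. split; [exact (IH _ _ hg)|exact eh].
Qed.

(** * Expansions of slopes and of the derivative *)

Lemma taylor_n_slope (n : nat) (h : C -> C) (z0 z : C) :
  z <> z0 -> taylor (S n) h z -> taylor (S n) (slope h z0) z.
Proof.
  intros nz hh. apply (taylor_ext _ (fun z => (h z - h z0) / (z - z0))).
  - generalize (near_neq _ _ nz). apply near_imp. intros w nw. unfold slope.
    destruct (Ceq_dec w z0); [contradiction|reflexivity].
  - apply taylor_div.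
    + apply taylor_minus; [exact hh|apply taylor_const].
    + apply taylor_minus; [apply taylor_id|apply taylor_const].
    + apply Cminus_neq_0, nz.
Qed.

Lemma has_pseries_slope (a : nat -> C) (h : C -> C) (z0 : C) :
  has_pseries a h z0 -> has_pseries (fun n => a (S n)) (slope h z0) z0.
Proof.
  intros ha. destruct (has_pseries_tail _ _ _ ha) as [g [hg eh]].
  generalize (near_and _ _ _ hg eh). apply near_imp. intros z [gz hz].
  replace (slope h z0 z) with (g z); [exact gz|]. unfold slope.
  destruct (Ceq_dec z z0) as [->|nz].
  - symmetry. apply C_derive_unique; [|exact eh].
    exact (has_pseries_taylor _ _ _ _ hg).
  - rewrite hz. field. apply Cminus_neq_0, nz.
Qed.

Lemma C_derive_slope (h : C -> C) (z0 z : C) :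
  taylor 2 (slope h z0) z ->
  C_derive h z = slope h z0 z + (z - z0) * C_derive (slope h z0) z.
Proof.
  intros hs. set (g := slope h z0) in *.
  (* The factor at [z] comes from (w - z0) g(w) - (z - z0) g(z) = (w - z) g(w) + (z - z0) (g(w) -
     g(z)). *)
  rewrite (C_derive_unique h (fun w => g w + (z - z0) * slope g z w)).
  - f_equal. f_equal. unfold slope.
    destruct (Ceq_dec z z); [reflexivity|contradiction].
  - apply taylor_plus; [apply taylor_pred; exact hs|].
    apply taylor_mult; [apply taylor_const|]. apply taylor_slope. exact hs.
  - exists 1%R. split; [lra|]. intros w _.
    rewrite (slope_eq h z0 w), (slope_eq h z0 z). fold g.
    replace ((z - z0) * g z) with ((z - z0) * g w - (z - z0) * (g w - g z)) by ring.
    rewrite (slope_eq g z w) at 3. ring.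
Qed.

Lemma C_derive_bound (h : C -> C) (z : C) (M : R) :
  taylor 2 h z ->
  near z (fun w => (Cmod (h w - h z) <= M * Cmod (w - z))%R) ->
  (Cmod (C_derive h z) <= M)%R.
Proof.
  intros hh hl. apply Rnot_lt_le. intros hM.
  assert (e : C_derive h z = slope h z z).
  { unfold slope. destruct (Ceq_dec z z); [reflexivity|contradiction]. }
  destruct (near_point _ _ (near_and _ _ _ hl
    (taylor_1_continuous _ _ (Cmod (C_derive h z) - M)
       (taylor_slope _ _ _ hh) ltac:(lra)))) as [w [nw [lw cw]]].
  rewrite <- e in cw.
  assert (b : (Cmod (slope h z w) <= M)%R).
  { rewrite (slope_eq h z w) in lw.
    replace (h z + (w - z) * slope h z w - h z)
      with ((w - z) * slope h z w) in lw by ring.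
    rewrite Cmod_mult in lw.
    assert (0 < Cmod (w - z))%R by (apply Cmod_gt_0, Cminus_neq_0, nw).
    apply Rmult_le_reg_l with (Cmod (w - z)); lra. }
  pose proof (Cmod_triangle (slope h z w) (- (slope h z w - C_derive h z))) as t.
  rewrite Cmod_opp in t.
  replace (slope h z w + - (slope h z w - C_derive h z))
    with (C_derive h z) in t by ring. lra.
Qed.

(** No termwise differentiation: h' = g + (z - z0) g' for the slope g at [z0], whose series is the
    shifted one, so an expansion of g' of order n gives one of h' of order n + 1. At order 0 the
    Lipschitz constant bounds h'. The second hypothesis makes the formula for h' valid at all points
    near [z0]. *)
Lemma has_pseries_taylor_derive (n : nat) (a : nat -> C) (h : C -> C) (z0 : C) :
  has_pseries a h z0 -> near z0 (fun z => forall k, taylor k h z) ->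
  taylor n (C_derive h) z0.
Proof.
  revert a h. induction n as [|n IH]; intros a h ha hn.
  - destruct (has_pseries_lipschitz _ _ _ ha) as [M [d [hd hl]]].
    exists M. generalize (near_and _ _ _ hn (near_near _ _ (near_ball z0 d hd))).
    apply near_imp. intros z [hz bz]. apply C_derive_bound; [apply hz|].
    pose proof (near_self _ _ bz) as bz0. generalize bz. apply near_imp.
    intros w bw. apply hl; assumption.
  - assert (hs : near z0 (fun z => forall k, taylor k (slope h z0) z)).
    { generalize hn. apply near_imp. intros z hz k.
      apply taylor_pred. destruct (Ceq_dec z z0) as [->|nz].
      - apply taylor_slope. apply hz.
      - apply taylor_n_slope; [exact nz|apply hz]. }
    apply (taylor_ext _ (fun z =>
      slope h z0 z + (z - z0) * C_derive (slope h z0) z)).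
    + generalize hs. apply near_imp. intros z hz. symmetry.
      apply C_derive_slope. apply hz.
    + apply taylor_plus; [apply (near_self _ _ hs)|].
      exists (C_derive (slope h z0)). split.
      * exact (IH _ _ (has_pseries_slope _ _ _ ha) hs).
      * exists 1%R. split; [lra|]. intros; ring.
Qed.

Lemma analytic_taylor (D : C -> Prop) (f : C -> C) (z : C) (n : nat) :
  analytic_on D f -> D z -> taylor n f z.
Proof.
  intros hf hz. destruct (hf z hz) as [r [a [hr ha]]].
  apply (has_pseries_taylor n a). exists r. auto.
Qed.

Lemma analytic_taylor_derive (D : C -> Prop) (f : C -> C) (z : C) (n : nat) :
  analytic_on D f -> near z D -> taylor n (C_derive f) z.
Proof.
  intros hf hz. destruct (hf z (near_self _ _ hz)) as [r [a [hr ha]]].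
  apply (has_pseries_taylor_derive n a); [exists r; auto|].
  generalize hz. apply near_imp. intros w hw k.
  exact (analytic_taylor D f w k hf hw).
Qed.

(** * Compactness and the maximum modulus principle *)

(** Passage from local radii to a uniform one, in a form that serves boundedness, attainment of a
    supremum and enlargement of a disk alike. The conclusion reaches slightly beyond radius [r],
    which the last use depends on. *)
Lemma disk_compactness (r : R) (Q : R -> C -> Prop) :
  (forall (d e : R) z, (0 < d)%R -> (d <= e)%R -> Q e z -> Q d z) ->
  (forall z, (Cmod z <= r)%R -> exists d : R, (0 < d)%R /\
     forall w, (Cmod (w - z) < d)%R -> Q d w) ->
  exists d : R, (0 < d)%R /\ forall w, (Cmod w < r + d)%R -> Q d w.
Proof.
  intros mono loc.
  (* A gauge on the whole plane, as the covering lemma works on a square. Outside the disk it is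
     (|z| - r)/4, which makes the condition vacuous, since |z| <= |w| + |w - z| < r + 3 d. The
     factor 2 absorbs the sqrt 2 between squares and disks. *)
  assert (hd : forall z : C, exists d : posreal, forall w,
    (Cmod (w - z) < 2 * d)%R -> (Cmod w < r + d)%R -> Q d w).
  { intros z. destruct (Rle_lt_dec (Cmod z) r) as [hz|hz].
    - destruct (loc z hz) as [d [d0 hd]].
      assert (d2 : (0 < d / 2)%R) by lra. exists (mkposreal _ d2). simpl.
      intros w hw _. apply (mono (d / 2)%R d); try lra. apply hd. lra.
    - assert (d4 : (0 < (Cmod z - r) / 4)%R) by lra.
      exists (mkposreal _ d4). simpl. intros w hw hr. exfalso.
      pose proof (Cmod_triangle w (- (w - z))) as t. rewrite Cmod_opp in t.
      replace (w + - (w - z)) with z in t by ring. lra. }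
  set (delta := fun u v : R =>
    proj1_sig (constructive_indefinite_description _ (hd (u, v)))).
  destruct (compactness_value_2d (- (r + 1)) (r + 1) (- (r + 1)) (r + 1) delta)
    as [d hcover].
  exists (Rmin d 1). split; [apply Rmin_pos; [apply cond_pos|lra]|].
  intros w hw. pose proof (Rmin_l d 1). pose proof (Rmin_r d 1).
  pose proof (Rmax_Cmod w) as hm.
  pose proof (Rmax_l (Rabs (fst w)) (Rabs (snd w))).
  pose proof (Rmax_r (Rabs (fst w)) (Rabs (snd w))).
  assert (b1 : (- (r + 1) <= fst w <= r + 1)%R) by (apply Rabs_le_between; lra).
  assert (b2 : (- (r + 1) <= snd w <= r + 1)%R) by (apply Rabs_le_between; lra).
  (* The covering lemma yields its centre only under a double negation. *)
  apply NNPP. intros nq. apply (hcover _ _ b1 b2).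
  intros [u [v [_ [_ [h1 [h2 h3]]]]]]. apply nq.
  apply (mono _ (delta u v)).
  - apply Rmin_pos; [apply cond_pos|lra].
  - lra.
  - unfold delta in *.
    destruct (constructive_indefinite_description _ (hd (u, v))) as [e he].
    simpl in *. apply he; [|lra].
    apply Rle_lt_trans with (1 := Cmod_2Rmax _). simpl.
    pose proof sqrt_2_lt_2.
    pose proof (sqrt_pos 2). pose proof (cond_pos e).
    assert (hx : (Rmax (Rabs (fst w + - u)) (Rabs (snd w + - v)) < e)%R)
      by (apply Rmax_lub_lt; assumption).
    pose proof (Rmax_l (Rabs (fst w + - u)) (Rabs (snd w + - v))).
    pose proof (Rabs_pos (fst w + - u)). nra.
Qed.

(** Compactness enters twice: with F <= 1/d for an upper bound, then with F <= m - d, which would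
    contradict the choice of the supremum [m] if it were not attained. *)
Lemma disk_max (r : R) (F : C -> R) :
  (0 <= r)%R ->
  (forall z, (Cmod z <= r)%R -> forall e, (0 < e)%R ->
     near z (fun w => (F w < F z + e)%R)) ->
  exists z, (Cmod z <= r)%R /\ forall w, (Cmod w <= r)%R -> (F w <= F z)%R.
Proof.
  intros hr usc.
  destruct (disk_compactness r (fun d w => (F w <= / d)%R)) as [b [hb hF]].
  - intros d e z hd hde hz. apply Rle_trans with (1 := hz).
    apply Rinv_le_contravar; assumption.
  - intros z hz. destruct (usc z hz 1%R ltac:(lra)) as [d [hd hw]].
    pose proof (Rabs_pos (F z)). pose proof (Rle_abs (F z)).
    exists (Rmin d (/ (Rabs (F z) + 1))). split.
    + apply Rmin_pos; [exact hd|]. apply Rinv_0_lt_compat. lra.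
    + intros w bw. apply Rle_trans with (Rabs (F z) + 1)%R.
      * pose proof (Rmin_l d (/ (Rabs (F z) + 1))).
        specialize (hw w ltac:(lra)). lra.
      * rewrite <- (Rinv_inv (Rabs (F z) + 1)) at 1.
        apply Rinv_le_contravar; [|apply Rmin_r].
        apply Rmin_pos; [exact hd|]. apply Rinv_0_lt_compat. lra.
  - destruct (completeness (fun x => exists w, (Cmod w <= r)%R /\ x = F w))
      as [m [hub hlub]].
    + exists (/ b)%R. intros x [w [hw ->]]. apply hF. lra.
    + exists (F 0), 0. rewrite Cmod_0. auto.
    + apply NNPP. intros no.
      assert (lt : forall w, (Cmod w <= r)%R -> (F w < m)%R).
      { intros w hw. apply Rnot_le_lt. intros hm. apply no. exists w.
        split; [exact hw|]. intros v hv. apply Rle_trans with (2 := hm).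
        apply hub. exists v. auto. }
      destruct (disk_compactness r (fun d w => (F w <= m - d)%R))
        as [d [hd hw]].
      * intros d e z _ hde hz. lra.
      * intros z hz. specialize (lt z hz).
        destruct (usc z hz ((m - F z) / 2)%R ltac:(lra)) as [d [hd hw]].
        pose proof (Rmin_l d ((m - F z) / 2)).
        pose proof (Rmin_r d ((m - F z) / 2)).
        exists (Rmin d ((m - F z) / 2)). split; [apply Rmin_pos; lra|].
        intros w bw. specialize (hw w ltac:(lra)). lra.
      * assert (m <= m - d)%R; [|lra]. apply hlub. intros x [w [bw ->]].
        apply hw. lra.
Qed.

Lemma Cmod2_perturb (x y : C) :
  (Cmod x ^ 2 - 2 * (Cmod x * Cmod y) <= Cmod (x + y) ^ 2)%R.
Proof.
  pose proof (Cmod_triangle (x + y) (- y)) as t. rewrite Cmod_opp in t.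
  replace (x + y + - y) with x in t by ring.
  pose proof (Cmod_ge_0 x). pose proof (Cmod_ge_0 y).
  pose proof (Cmod_ge_0 (x + y)).
  destruct (Rle_lt_dec (Cmod x) (Cmod y)); [nra|].
  assert ((Cmod x - Cmod y) ^ 2 <= Cmod (x + y) ^ 2)%R by (apply pow_incr; lra).
  nra.
Qed.

Lemma near_shift (z : C) (P : C -> Prop) :
  near z P -> exists d : R, (0 < d)%R /\
    forall u, (Cmod u < d)%R -> P (z + u).
Proof.
  intros [d [hd hP]]. exists d. split; [exact hd|]. intros u hu. apply hP.
  replace (z + u - z) with u by ring. exact hu.
Qed.

(* The mean of [|h|^2 + e |z|^2] over the four points [z + s i^k] exceeds its
   value at [z] by at least [e s^2 - O(s^3)], since the terms of [|h|^2] that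
   are not subharmonic at second order cancel. *)
Lemma no_local_max (h : C -> C) (z : C) (e : R) :
  taylor 3 h z -> (0 < e)%R ->
  ~ near z (fun w =>
      (Cmod (h w) ^ 2 + e * Cmod w ^ 2 <= Cmod (h z) ^ 2 + e * Cmod z ^ 2)%R).
Proof.
  intros [g1 [[g2 [[g3 [[M hM] e3]] e2]] e1]] he hmax.
  destruct (near_shift _ _ (near_and _ _ _ hmax (near_and _ _ _ hM
    (near_and _ _ _ e1 (near_and _ _ _ e2 e3))))) as [d [hd H]]. clear - hd H he.
  set (a0 := h z) in *. set (a1 := g1 z) in *. set (a2 := g2 z) in *.
  set (N := (Cmod a0 + Cmod a1 + Cmod a2)%R).
  assert (hN : (0 <= N)%R).
  { unfold N. pose proof (Cmod_ge_0 a0). pose proof (Cmod_ge_0 a1).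
    pose proof (Cmod_ge_0 a2). lra. }
  set (K := (N * Rabs M + 1)%R).
  assert (hK : (0 < K)%R) by (unfold K; pose proof (Rabs_pos M); nra).
  (* The bound s <= 1 keeps the quadratic part of [h] below [N], so that dropping the cubic
     remainder costs at most 2 K s^3. Averaging then gives e s^2 <= 2 K s^3, against 4 K s <= e. *)
  set (s := Rmin (d / 2) (Rmin 1 (e / (4 * K)))).
  assert (hs : (0 < s)%R).
  { unfold s. repeat apply Rmin_pos; try lra. apply Rdiv_lt_0_compat; lra. }
  assert (sd : (s < d)%R).
  { unfold s. pose proof (Rmin_l (d / 2) (Rmin 1 (e / (4 * K)))). lra. }
  assert (s1 : (s <= 1)%R).
  { unfold s. apply Rle_trans with (1 := Rmin_r _ _). apply Rmin_l. }
  assert (sk : (4 * K * s <= e)%R).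
  { assert (s <= e / (4 * K))%R.
    { unfold s. apply Rle_trans with (1 := Rmin_r _ _). apply Rmin_r. }
    replace e with (4 * K * (e / (4 * K)))%R by (field; lra).
    apply Rmult_le_compat_l; lra. }
  assert (key : forall u, Cmod u = s ->
    (Cmod (a0 + a1 * u + a2 * (u * u)) ^ 2 + e * Cmod (z + u) ^ 2
      <= Cmod a0 ^ 2 + e * Cmod z ^ 2 + 2 * K * s ^ 3)%R).
  { intros u hu. destruct (H u ltac:(lra)) as [h0 [h3 [q1 [q2 q3]]]].
    replace (z + u - z) with u in * by ring.
    assert (q : h (z + u) = a0 + a1 * u + a2 * (u * u) + u * u * u * g3 (z + u)).
    { rewrite q1, q2, q3. ring. }
    rewrite q in h0.
    set (X := a0 + a1 * u + a2 * (u * u)) in *.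
    set (Y := u * u * u * g3 (z + u)) in *.
    pose proof (Cmod2_perturb X Y).
    assert (hX : (Cmod X <= N)%R).
    { unfold X, N. apply Rle_trans with (1 := Cmod_triangle _ _).
      pose proof (Cmod_triangle a0 (a1 * u)). rewrite !Cmod_mult, hu in *.
      pose proof (Cmod_ge_0 a1). pose proof (Cmod_ge_0 a2).
      assert (s * s <= 1)%R by nra. nra. }
    assert (hY : (Cmod Y <= s ^ 3 * Rabs M)%R).
    { unfold Y. rewrite !Cmod_mult, hu. pose proof (Rle_abs M).
      replace (s * s * s)%R with (s ^ 3)%R by ring.
      apply Rmult_le_compat_l; [apply pow_le|]; lra. }
    assert (hXY : (Cmod X * Cmod Y <= N * (s ^ 3 * Rabs M))%R).
    { apply Rmult_le_compat; auto using Cmod_ge_0. }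
    assert (0 < s ^ 3)%R by (apply pow_lt; exact hs).
    unfold K. nra. }
  assert (ns : Cmod (RtoC s) = s) by (rewrite Cmod_R; apply Rabs_pos_eq; lra).
  assert (ni : Cmod (Ci * RtoC s) = s) by (rewrite Cmod_mult, Cmod_Ci, ns; ring).
  pose proof (key _ ns) as k1. pose proof (key _ ni) as k3.
  rewrite <- Cmod_opp in ns, ni.
  pose proof (key _ ns) as k2. pose proof (key _ ni) as k4.
  rewrite !Cmod2_alt in k1, k2, k3, k4.
  clearbody a0 a1 a2 K s. clear key H ns ni.
  destruct a0 as [x0 y0], a1 as [x1 y1], a2 as [x2 y2], z as [x y]. simpl in *.
  assert (hs2 : (0 < s * s)%R) by nra.
  assert (hks : (4 * K * (s * (s * s)) <= e * (s * s))%R).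
  { replace (4 * K * (s * (s * s)))%R with (4 * K * s * (s * s))%R by ring.
    apply Rmult_le_compat_r; lra. }
  assert (0 < e * (s * s))%R by nra.
  assert (p1 : (0 <= (x1 * x1 + y1 * y1) * (s * s))%R) by nra.
  assert (p2 : (0 <= (x2 * x2 + y2 * y2) * (s * s) * (s * s))%R) by nra.
  ring_simplify in k1. ring_simplify in k2. ring_simplify in k3.
  ring_simplify in k4. ring_simplify in hks. ring_simplify in p1.
  ring_simplify in p2. lra.
Qed.

Lemma taylor_1_Cmod2 (h : C -> C) (z : C) (e : R) :
  taylor 1 h z -> (0 < e)%R ->
  near z (fun w => (Cmod (h w) ^ 2 < Cmod (h z) ^ 2 + e)%R).
Proof.
  intros hh he. set (A := Cmod (h z)).
  assert (hA : (0 <= A)%R) by apply Cmod_ge_0.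
  set (t := Rmin 1 (e / (2 * A + 2))).
  assert (ht : (0 < t)%R).
  { apply Rmin_pos; [lra|]. apply Rdiv_lt_0_compat; lra. }
  assert (t1 : (t <= 1)%R) by apply Rmin_l.
  assert (te : (t * (2 * A + 2) <= e)%R).
  { replace e with (e / (2 * A + 2) * (2 * A + 2))%R by (field; lra).
    apply Rmult_le_compat_r; [lra|]. apply Rmin_r. }
  generalize (taylor_1_continuous _ _ t hh ht). apply near_imp. intros w hw.
  pose proof (Cmod_triangle (h z) (h w - h z)) as tr.
  replace (h z + (h w - h z)) with (h w) in tr by ring. fold A in tr.
  pose proof (Cmod_ge_0 (h w)). nra.
Qed.

(** Adding e |z|^2 makes |h|^2 strictly subharmonic, so the maximum over the closed disk lies on the
    circle and |h|^2 <= B^2 + e r^2 throughout; then e tends to 0. *)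
Lemma max_modulus (h : C -> C) (r B : R) :
  (forall z, (Cmod z <= r)%R -> taylor 3 h z) ->
  (forall z, Cmod z = r -> (Cmod (h z) <= B)%R) ->
  forall z, (Cmod z <= r)%R -> (Cmod (h z) <= B)%R.
Proof.
  intros hh hB z hz. pose proof (Cmod_ge_0 z) as hz0.
  assert (hB0 : (0 <= B)%R).
  { apply Rle_trans with (1 := Cmod_ge_0 (h (RtoC r))). apply hB.
    rewrite Cmod_R. apply Rabs_pos_eq. lra. }
  apply Rsqr_incr_0_var; [|exact hB0]. rewrite !Rsqr_pow2.
  apply le_epsilon. intros e0 he0.
  (* Chosen so that e r^2 <= e0; the added 1 allows r = 0. *)
  set (e := (e0 / (r ^ 2 + 1))%R).
  assert (hr2 : (0 <= r ^ 2)%R) by apply pow2_ge_0.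
  assert (he : (0 < e)%R) by (apply Rdiv_lt_0_compat; lra).
  destruct (disk_max r (fun w => Cmod (h w) ^ 2 + e * Cmod w ^ 2)%R)
    as [z1 [hz1 hmax]]; [lra| |].
  - intros w hw t ht.
    assert (ht2 : (0 < t / 2 / e)%R) by (apply Rdiv_lt_0_compat; lra).
    generalize (near_and _ _ _
      (taylor_1_Cmod2 h w (t / 2) (taylor_le 1 3 h w ltac:(lia) (hh w hw)) ltac:(lra))
      (taylor_1_Cmod2 (fun z => z) w (t / 2 / e) (taylor_id 1 w) ht2)).
    apply near_imp. intros v [h1 h2].
    assert (e * Cmod v ^ 2 < e * (Cmod w ^ 2 + t / 2 / e))%R
      by (apply Rmult_lt_compat_l; lra).
    replace (e * (Cmod w ^ 2 + t / 2 / e))%R with (e * Cmod w ^ 2 + t / 2)%R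
      in * by (field; lra). lra.
  - destruct (Rle_lt_or_eq_dec _ _ hz1) as [lt|eq].
    + exfalso. apply (no_local_max h z1 e (hh z1 hz1) he).
      exists (r - Cmod z1)%R. split; [lra|]. intros w hw. apply hmax.
      pose proof (Cmod_triangle z1 (w - z1)) as t.
      replace (z1 + (w - z1)) with w in t by ring. lra.
    + specialize (hmax z hz). simpl in hmax.
      specialize (hB z1 eq). pose proof (Cmod_ge_0 (h z1)).
      rewrite eq in hmax. pose proof (pow2_ge_0 (Cmod z)).
      assert (e * (r ^ 2 + 1) = e0)%R by (unfold e; field; lra).
      assert (Cmod (h z1) ^ 2 <= B ^ 2)%R by (apply pow_incr; lra).
      simpl in *. nra.
Qed.

(** * Derivatives along rays *)

Lemma taylor_2_ray (h : C -> C) (z0 : C) (t0 : R) :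
  taylor 2 h (RtoC t0 * z0) ->
  exists M d : R, (0 < d)%R /\ forall s, (Rabs s < d)%R ->
    (Cmod (h (RtoC (t0 + s)%R * z0)%C - h (RtoC t0 * z0)%C
       - RtoC s * (z0 * C_derive h (RtoC t0 * z0)))%C <= M * (s * s))%R.
Proof.
  intros [g1 [hg1 e1]]. rewrite (C_derive_unique h g1); [|exact hg1|exact e1].
  destruct hg1 as [g2 [[M hM] e2]]. set (z := RtoC t0 * z0) in *.
  destruct (near_shift _ _ (near_and _ _ _ hM (near_and _ _ _ e1 e2)))
    as [d [hd H]].
  pose proof (Cmod_ge_0 z0).
  (* The displacement is s z0, so the remainder bound picks up |z0|^2; the added 1 covers z0 = 0. *)
  exists (Cmod z0 * Cmod z0 * M)%R, (d / (Cmod z0 + 1))%R.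
  split; [apply Rdiv_lt_0_compat; lra|]. intros s hs.
  replace (RtoC (t0 + s)%R * z0) with (z + RtoC s * z0)
    by (unfold z; rewrite RtoC_plus; ring).
  assert (hu : (Cmod (RtoC s * z0) < d)%R).
  { rewrite Cmod_mult, Cmod_R.
    replace d with (d / (Cmod z0 + 1) * (Cmod z0 + 1))%R by (field; lra).
    pose proof (Rabs_pos s).
    apply Rle_lt_trans with (Rabs s * (Cmod z0 + 1))%R; [nra|].
    apply Rmult_lt_compat_r; lra. }
  destruct (H _ hu) as [h3 [q1 q2]].
  replace (z + RtoC s * z0 - z) with (RtoC s * z0) in * by ring.
  rewrite q1, q2.
  replace (h z + RtoC s * z0 * (g1 z + RtoC s * z0 * g2 (z + RtoC s * z0))
    - h z - RtoC s * (z0 * g1 z))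
    with (RtoC s * z0 * (RtoC s * z0) * g2 (z + RtoC s * z0)) by ring.
  rewrite !Cmod_mult, Cmod_R.
  replace (Cmod z0 * Cmod z0 * M * (s * s))%R
    with (Rabs s * Cmod z0 * (Rabs s * Cmod z0) * M)%R.
  - apply Rmult_le_compat_l; [|exact h3]. pose proof (Rabs_pos s).
    apply Rmult_le_pos; apply Rmult_le_pos; lra.
  - rewrite <- (Rabs_pos_eq (s * s)) by nra. rewrite Rabs_mult. ring.
Qed.

Lemma is_derive_of_quadratic_error (f : R -> R) (t l M d : R) :
  (0 < d)%R ->
  (forall s, (Rabs s < d)%R -> (Rabs (f (t + s) - f t - s * l) <= M * (s * s))%R) ->
  is_derive f t l.
Proof.
  intros hd H. apply is_derive_Reals. intros e he.
  pose proof (Rabs_pos M). pose proof (Rle_abs M).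
  assert (hp : (0 < Rmin d (e / (Rabs M + 1)))%R).
  { apply Rmin_pos; [exact hd|]. apply Rdiv_lt_0_compat; lra. }
  exists (mkposreal _ hp). simpl. intros s ns hs.
  pose proof (Rmin_l d (e / (Rabs M + 1))). pose proof (Rmin_r d (e / (Rabs M + 1))).
  specialize (H s ltac:(lra)).
  replace ((f (t + s) - f t) / s - l)%R with ((f (t + s) - f t - s * l) / s)%R
    by (field; exact ns).
  rewrite Rabs_div by exact ns. pose proof (Rabs_pos_lt s ns) as ps.
  apply Rmult_lt_reg_r with (1 := ps). unfold Rdiv.
  rewrite Rmult_assoc, Rinv_l, Rmult_1_r by lra.
  apply Rle_lt_trans with (1 := H).
  replace (s * s)%R with (Rabs s * Rabs s)%R
    by (rewrite <- Rabs_mult; apply Rabs_pos_eq; nra).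
  rewrite <- Rmult_assoc. apply Rmult_lt_compat_r; [exact ps|].
  apply Rle_lt_trans with (Rabs M * Rabs s)%R; [nra|].
  apply Rle_lt_trans with (Rabs M * (e / (Rabs M + 1)))%R; [nra|].
  assert (0 < e / (Rabs M + 1))%R by (apply Rdiv_lt_0_compat; lra).
  apply Rlt_le_trans with ((Rabs M + 1) * (e / (Rabs M + 1)))%R; [nra|].
  right. field. lra.
Qed.

Lemma is_derive_Re_ray (h : C -> C) (z0 : C) (t0 : R) :
  taylor 2 h (RtoC t0 * z0) ->
  is_derive (fun t => Re (h (RtoC t * z0))) t0
    (Re (z0 * C_derive h (RtoC t0 * z0))).
Proof.
  intros hh. destruct (taylor_2_ray h z0 t0 hh) as [M [d [hd H]]].
  apply (is_derive_of_quadratic_error _ _ _ M d hd). intros s hs.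
  apply Rle_trans with (2 := H s hs). apply Rle_trans with (2 := re_le_Cmod _).
  right. f_equal.
  generalize (h (RtoC (t0 + s)%R * z0)) (h (RtoC t0 * z0))
    (z0 * C_derive h (RtoC t0 * z0)).
  intros; unfold Re, Im; simpl; ring.
Qed.

Lemma is_derive_Im_ray (h : C -> C) (z0 : C) (t0 : R) :
  taylor 2 h (RtoC t0 * z0) ->
  is_derive (fun t => Im (h (RtoC t * z0))) t0
    (Im (z0 * C_derive h (RtoC t0 * z0))).
Proof.
  intros hh. destruct (taylor_2_ray h z0 t0 hh) as [M [d [hd H]]].
  apply (is_derive_of_quadratic_error _ _ _ M d hd). intros s hs.
  apply Rle_trans with (2 := H s hs).
  apply Rle_trans with (2 := Rmax_Cmod _). apply Rle_trans with (2 := Rmax_r _ _).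
  right. f_equal.
  generalize (h (RtoC (t0 + s)%R * z0)) (h (RtoC t0 * z0))
    (z0 * C_derive h (RtoC t0 * z0)).
  intros; unfold Re, Im; simpl; ring.
Qed.

Lemma is_derive_sum_squares (F G : R -> R) (t a b : R) :
  is_derive F t a -> is_derive G t b ->
  is_derive (fun t => F t ^ 2 + G t ^ 2)%R t (2 * (F t * a + G t * b))%R.
Proof.
  intros hF hG. auto_derive.
  - split; [eexists; exact hF|]. split; [eexists; exact hG|]. exact I.
  - replace (Derive (fun x => F x) t) with a
      by (symmetry; exact (is_derive_unique _ _ _ hF)).
    replace (Derive (fun x => G x) t) with b
      by (symmetry; exact (is_derive_unique _ _ _ hG)).
    ring.
Qed.

Lemma is_derive_Cmod2_ray (h : C -> C) (z0 : C) (t0 : R) :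
  taylor 2 h (RtoC t0 * z0) ->
  is_derive (fun t => Cmod (h (RtoC t * z0)%C) ^ 2)%R t0
    (2 * Re (Cconj (h (RtoC t0 * z0)%C) * (z0 * C_derive h (RtoC t0 * z0))))%R.
Proof.
  intros hh.
  apply (is_derive_ext
    (fun t => Re (h (RtoC t * z0)%C) ^ 2 + Im (h (RtoC t * z0)%C) ^ 2)%R).
  { intros t. symmetry. apply Cmod2_alt. }
  replace (2 * Re (Cconj (h (RtoC t0 * z0)%C) * (z0 * C_derive h (RtoC t0 * z0))))%R
    with (2 * (Re (h (RtoC t0 * z0)%C) * Re (z0 * C_derive h (RtoC t0 * z0))
             + Im (h (RtoC t0 * z0)%C) * Im (z0 * C_derive h (RtoC t0 * z0))))%R.
  - apply (is_derive_sum_squares (fun t => Re (h (RtoC t * z0)))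
      (fun t => Im (h (RtoC t * z0)))).
    + apply is_derive_Re_ray. exact hh.
    + apply is_derive_Im_ray. exact hh.
  - generalize (h (RtoC t0 * z0)) (z0 * C_derive h (RtoC t0 * z0)).
    intros; unfold Re, Im; simpl; ring.
Qed.

(** * Starlikeness *)

Lemma derive_nonpos_of_left_nonneg (F : R -> R) (t l : R) :
  is_derive F t l -> F t = 0%R ->
  (forall s, (0 < s < 1)%R -> (0 <= F (t - s))%R) -> (l <= 0)%R.
Proof.
  intros hF h0 hpos. apply is_derive_Reals in hF. apply Rnot_lt_le. intros hl.
  destruct (hF l hl) as [d hd].
  set (s := Rmin (1 / 2) (d / 2)). pose proof (cond_pos d).
  assert (hs : (0 < s)%R) by (apply Rmin_pos; lra).
  pose proof (Rmin_l (1 / 2) (d / 2)). pose proof (Rmin_r (1 / 2) (d / 2)).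
  fold s in H0, H1. specialize (hpos s ltac:(lra)).
  specialize (hd (- s)%R ltac:(lra)). rewrite Rabs_Ropp, Rabs_pos_eq in hd by lra.
  specialize (hd ltac:(lra)). apply Rabs_lt_between in hd. rewrite h0 in hd.
  replace (t + - s)%R with (t - s)%R in hd by ring.
  assert (e : ((F (t - s) - 0) / - s = - (F (t - s) * / s))%R) by (field; lra).
  rewrite e in hd. pose proof (Rinv_0_lt_compat s hs). nra.
Qed.

(* By the Schwarz lemma for [(p - 1) / (p + 1)],
   [F t = t^2 |p (t z0) + 1|^2 - |p (t z0) - 1|^2] is nonnegative on [0, 1],
   and it vanishes at [t = 1]; the bound is [F' 1 <= 0]. *)
Lemma caratheodory_boundary_derivative (p : C -> C) (z0 : C) :
  z0 <> 0 -> (forall z n, (Cmod z <= Cmod z0)%R -> taylor n p z) -> p 0 = 1 ->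
  (forall z, (Cmod z <= Cmod z0)%R -> (0 <= Re (p z))%R) -> Re (p z0) = 0%R ->
  (2 * Re (z0 * C_derive p z0) <= - (1 + Im (p z0) ^ 2))%R.
Proof.
  intros nz0 hp p0 hre hz0. set (r := Cmod z0) in *.
  assert (hr : (0 < r)%R) by (apply Cmod_gt_0; exact nz0).
  assert (n1 : forall z, (Cmod z <= r)%R -> p z + 1 <> 0).
  { intros z hz e. specialize (hre z hz).
    assert (e' : Re (p z + 1) = 0%R) by (rewrite e; reflexivity).
    unfold Re in *. simpl in e'. lra. }
  assert (le1 : forall z, (Cmod z <= r)%R -> (Cmod (p z - 1) <= Cmod (p z + 1))%R).
  { intros z hz. specialize (hre z hz). apply Rsqr_incr_0; try apply Cmod_ge_0.
    rewrite !Rsqr_pow2, !Cmod2_alt. unfold Re, Im in *. simpl. nra. }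
  (* This is (p - 1)/(p + 1) divided by z, with the singularity at 0 filled in. As Re p >= 0 holds
     on the circle too, the maximum principle applies on the closed disk without a limit over
     smaller radii. *)
  set (h := fun z => slope p 0 z / (p z + 1)).
  assert (sl : forall z, p z - 1 = z * slope p 0 z).
  { intros z. rewrite (slope_eq p 0 z) at 1. rewrite p0. ring. }
  assert (hh : forall z, (Cmod z <= r)%R -> (Cmod (h z) <= / r)%R).
  { apply max_modulus.
    - intros z hz. apply taylor_div; [| |apply n1; exact hz].
      + destruct (Ceq_dec z 0) as [->|nz].
        * apply taylor_slope. apply hp. exact hz.
        * apply taylor_n_slope; [exact nz|]. apply hp. exact hz.
      + apply taylor_plus; [|apply taylor_const]. apply hp. exact hz.
    - intros z ez. assert (hz : (Cmod z <= r)%R) by lra.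
      pose proof (n1 z hz) as nz1. pose proof (proj1 (Cmod_gt_0 _) nz1).
      specialize (le1 z hz). rewrite sl, Cmod_mult, ez in le1.
      unfold h. rewrite Cmod_div by exact nz1.
      apply Rmult_le_reg_r with (Cmod (p z + 1)); [lra|].
      unfold Rdiv. rewrite Rmult_assoc, Rinv_l, Rmult_1_r by lra.
      apply Rmult_le_reg_l with (1 := hr).
      rewrite <- Rmult_assoc, Rinv_r, Rmult_1_l by lra. exact le1. }
  assert (schwarz : forall t, (0 <= t <= 1)%R ->
    (Cmod (p (RtoC t * z0)%C - 1) <= t * Cmod (p (RtoC t * z0)%C + 1))%R).
  { intros t ht. set (z := RtoC t * z0).
    assert (ez : Cmod z = (t * r)%R).
    { unfold z. rewrite Cmod_mult, Cmod_R, Rabs_pos_eq by lra. reflexivity. }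
    assert (hz : (Cmod z <= r)%R) by (rewrite ez; nra).
    assert (e : p z - 1 = z * (h z * (p z + 1))).
    { rewrite sl. unfold h. field. apply n1. exact hz. }
    rewrite e, !Cmod_mult, ez. specialize (hh z hz).
    pose proof (Cmod_ge_0 (p z + 1)).
    replace (t * Cmod (p z + 1))%R with (t * r * (/ r * Cmod (p z + 1)))%R
      by (field; lra).
    apply Rmult_le_compat_l; [nra|]. apply Rmult_le_compat_r; lra. }
  pose proof (hp z0 2%nat (Rle_refl _)) as h2.
  replace z0 with (RtoC 1 * z0) in h2 at 1 by ring.
  pose proof (is_derive_Re_ray p z0 1 h2) as d1.
  pose proof (is_derive_Im_ray p z0 1 h2) as d2.
  replace (RtoC 1 * z0) with z0 in d1, d2 by ring.
  set (q := z0 * C_derive p z0) in *.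
  set (a := fun t => Re (p (RtoC t * z0))) in *.
  set (b := fun t => Im (p (RtoC t * z0))) in *.
  assert (a1 : a 1%R = 0%R).
  { unfold a. replace (RtoC 1 * z0) with z0 by ring. exact hz0. }
  assert (b1 : b 1%R = Im (p z0)).
  { unfold b. replace (RtoC 1 * z0) with z0 by ring. reflexivity. }
  (* At t = 1 the factor t^2 contributes 2 (1 + y^2); as a(1) = 0, the squares of a + 1 and a - 1
     contribute 4 a'(1), and the terms in b' cancel. *)
  assert (dF : is_derive
    (fun t => t ^ 2 * ((a t + 1) ^ 2 + b t ^ 2) - ((a t - 1) ^ 2 + b t ^ 2))%R 1%R
    (2 * (1 + Im (p z0) ^ 2) + 4 * Re q)%R).
  { auto_derive.
    - repeat split; eexists; first [exact d1|exact d2].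
    - replace (Derive (fun x => a x) 1) with (Re q)
        by (symmetry; exact (is_derive_unique _ _ _ d1)).
      replace (Derive (fun x => b x) 1) with (Im q)
        by (symmetry; exact (is_derive_unique _ _ _ d2)).
      rewrite a1, b1. ring. }
  apply derive_nonpos_of_left_nonneg in dF.
  - lra.
  - rewrite a1. ring.
  - intros s hs. specialize (schwarz (1 - s)%R ltac:(lra)).
    assert (sq : (Cmod (p (RtoC (1 - s)%R * z0)%C - 1) ^ 2 <=
      ((1 - s) * Cmod (p (RtoC (1 - s)%R * z0)%C + 1)) ^ 2)%R).
    { apply pow_incr. split; [apply Cmod_ge_0|exact schwarz]. }
    rewrite Rpow_mult_distr, !Cmod2_alt in sq. unfold a, b.
    generalize dependent (p (RtoC (1 - s)%R * z0)). intros w _ hw.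
    unfold Re, Im in *. simpl in *. nra.
Qed.

(** * Regularity of z f'/f and nonvanishing of f *)

Lemma near_unit_disk (z : C) : unit_disk z -> near z unit_disk.
Proof.
  intros hz. exists (1 - Cmod z)%R. unfold unit_disk in *. split; [lra|].
  intros w hw. pose proof (Cmod_triangle z (w - z)) as t.
  replace (z + (w - z)) with w in t by ring. lra.
Qed.

Lemma zdlog_0 (f : C -> C) : zdlog f 0 = 1.
Proof. unfold zdlog. destruct (Ceq_dec 0 0); [reflexivity|contradiction]. Qed.

Lemma zdlog_neq_0 (f : C -> C) (z : C) :
  z <> 0 -> zdlog f z = z * C_derive f z / f z.
Proof. intros nz. unfold zdlog. destruct (Ceq_dec z 0); [contradiction|reflexivity]. Qed.

(** At a zero of [f] off the origin the convention / 0 = 0 gives the value 0, so positivity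
    certifies a genuine quotient. *)
Lemma zdlog_defined (f : C -> C) (z : C) :
  (0 < Re (zdlog f z))%R -> z = 0 \/ f z <> 0.
Proof.
  intros hp. destruct (Ceq_dec z 0) as [e|nz]; [left; exact e|right].
  intros e. rewrite zdlog_neq_0, e in hp by exact nz.
  replace (z * C_derive f z / 0) with (RtoC 0) in hp; [simpl in hp; lra|].
  unfold Cdiv. replace (/ 0) with (RtoC 0).
  - ring.
  - unfold Cinv, RtoC. simpl. f_equal; unfold Rdiv; ring.
Qed.

(** At the origin, cancelling z turns the quotient into f' divided by the slope of [f] at 0, whose
    value there is f'(0) = 1; elsewhere it is a plain quotient. *)
Lemma zdlog_taylor (f : C -> C) (z : C) (n : nat) :
  class_A f -> unit_disk z -> z = 0 \/ f z <> 0 -> taylor n (zdlog f) z.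
Proof.
  (* Quotients are available only at successor orders, so one extra order is proved. *)
  intros [an [f0 df0]] hz hd. apply taylor_pred.
  pose proof (fun k => analytic_taylor _ _ _ k an hz) as tf.
  pose proof (analytic_taylor_derive _ _ _ (S n) an (near_unit_disk _ hz)) as td.
  destruct (Ceq_dec z 0) as [->|nz].
  - assert (s0 : slope f 0 0 <> 0).
    { unfold slope. destruct (Ceq_dec 0 0) as [_|nn]; [|contradiction].
      rewrite df0. intros e. apply RtoC_inj in e. lra. }
    apply (taylor_ext _ (fun w => C_derive f w / slope f 0 w)).
    + generalize (taylor_1_nonzero _ _ (taylor_slope 0 f 0 (tf 2%nat)) s0).
      apply near_imp. intros w hw. destruct (Ceq_dec w 0) as [->|nw].
      * rewrite zdlog_0. unfold slope.
        destruct (Ceq_dec 0 0) as [_|nn]; [|contradiction].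
        rewrite df0. field.
      * rewrite (zdlog_neq_0 f w nw).
        assert (e : f w = w * slope f 0 w).
        { rewrite (slope_eq f 0 w) at 1. rewrite f0. ring. }
        rewrite e. field. split; assumption.
    + apply taylor_div; [exact td| |exact s0]. apply taylor_slope, tf.
  - destruct hd as [e|fz]; [contradiction|].
    apply (taylor_ext _ (fun w => w * C_derive f w / f w)).
    + generalize (near_neq z 0 nz). apply near_imp. intros w nw.
      symmetry. apply zdlog_neq_0. exact nw.
    + apply taylor_div; [|apply tf|exact fz].
      apply taylor_mult; [apply taylor_id|exact td].
Qed.

(** Radial approach from inside, by which inequalities on an open disk pass to its boundary
    circle. *)
Lemma near_ray (z : C) (P : C -> Prop) :
  near z P -> exists t : R, (0 < t < 1)%R /\ P (RtoC t * z).
Proof.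
  intros [d [hd hP]]. pose proof (Cmod_ge_0 z).
  set (s := Rmin (1 / 2) (d / (2 * (Cmod z + 1)))).
  assert (hs : (0 < s)%R).
  { apply Rmin_pos; [lra|]. apply Rdiv_lt_0_compat; lra. }
  assert (s1 : (s <= 1 / 2)%R) by apply Rmin_l.
  assert (s2 : (s * (2 * (Cmod z + 1)) <= d)%R).
  { replace d with (d / (2 * (Cmod z + 1)) * (2 * (Cmod z + 1)))%R
      by (field; lra).
    apply Rmult_le_compat_r; [lra|]. apply Rmin_r. }
  exists (1 - s)%R. split; [lra|]. apply hP.
  replace (RtoC (1 - s) * z - z) with (- (RtoC s * z))
    by (rewrite RtoC_minus; ring).
  rewrite Cmod_opp, Cmod_mult, Cmod_R, Rabs_pos_eq by lra. nra.
Qed.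

(* [|f|] increases along rays as long as [Re (z f' / f) > 0]. *)
Lemma nonzero_at_first_boundary (f : C -> C) (z0 : C) :
  class_A f -> unit_disk z0 -> z0 <> 0 ->
  (forall z, (Cmod z < Cmod z0)%R -> (0 < Re (zdlog f z))%R) -> f z0 <> 0.
Proof.
  intros [an _] hz0 nz0 hp e.
  assert (m0 : (0 < Cmod z0)%R) by (apply Cmod_gt_0; exact nz0).
  assert (mt : forall t, (1 / 2 <= t)%R -> Cmod (RtoC t * z0) = (t * Cmod z0)%R).
  { intros t ht. rewrite Cmod_mult, Cmod_R, Rabs_pos_eq by lra. reflexivity. }
  assert (nzt : forall t, (1 / 2 <= t < 1)%R ->
    f (RtoC t * z0) <> 0 /\ RtoC t * z0 <> 0).
  { intros t ht.
    assert (nz : RtoC t * z0 <> 0) by (apply Cmod_gt_0; rewrite mt; nra).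
    split; [|exact nz].
    destruct (zdlog_defined f (RtoC t * z0)); [|contradiction|assumption].
    apply hp. rewrite mt by lra. nra. }
  set (phi := fun t => (Cmod (f (RtoC t * z0)%C) ^ 2)%R).
  set (dphi := fun t =>
    (2 * Re (Cconj (f (RtoC t * z0)%C) * (z0 * C_derive f (RtoC t * z0)%C)))%R).
  assert (hd : forall t, (1 / 2 <= t <= 1)%R -> is_derive phi t (dphi t)).
  { intros t ht. apply is_derive_Cmod2_ray. apply (analytic_taylor _ _ _ _ an).
    unfold unit_disk in *. rewrite mt by lra. nra. }
  (* If f(z0) = 0, then |f(t z0)|^2 falls from a positive value at 1/2 to 0 at 1, so its derivative
     is negative at some [c]. Starting at 1/2 avoids the origin. The endpoint c = 1 is not excluded
     by the mean value theorem, but there the factor f(z0) = 0 makes the derivative 0. *)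
  destruct (MVT_gen phi (1 / 2) 1 dphi) as [c [hc ec]].
  - rewrite Rmin_left, Rmax_right by lra. intros; apply hd; lra.
  - rewrite Rmin_left, Rmax_right by lra. intros t ht.
    apply derivable_continuous_pt. exists (dphi t).
    apply is_derive_Reals. apply hd. exact ht.
  - rewrite Rmin_left, Rmax_right in hc by lra.
    assert (p1 : phi 1%R = 0%R).
    { unfold phi. replace (RtoC 1 * z0) with z0 by ring. rewrite e, Cmod_0. ring. }
    assert (p2 : (0 < phi (1 / 2))%R).
    { unfold phi. apply pow_lt, Cmod_gt_0, nzt. lra. }
    rewrite p1 in ec. destruct (proj2 hc) as [lt|eq].
    + destruct (nzt c ltac:(lra)) as [fc nc].
      assert (hpc : (0 < Re (zdlog f (RtoC c * z0)%C))%R).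
      { apply hp. rewrite mt by lra. nra. }
      rewrite zdlog_neq_0 in hpc by exact nc. unfold dphi in ec.
      set (w := f (RtoC c * z0)) in *. set (q := C_derive f (RtoC c * z0)) in *.
      set (v := RtoC c * z0 * q / w) in *.
      (* Up to the factor c/2, the radial derivative of |f|^2 is |f|^2 Re (z f'/f), hence
         positive. *)
      assert (ev : RtoC c * (Cconj w * (z0 * q)) = RtoC (Cmod w ^ 2) * v).
      { rewrite Cmod2_conj. unfold v. field. exact fc. }
      apply (f_equal Re) in ev.
      assert (hw : (0 < Cmod w ^ 2)%R) by (apply pow_lt, Cmod_gt_0; exact fc).
      generalize dependent (Cconj w * (z0 * q)). intros x ex ev.
      generalize dependent (Cmod w ^ 2)%R. intros m hm hm'.
      unfold Re in *. simpl in *. nra.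
    + subst c. unfold dphi in ec. replace (RtoC 1 * z0) with z0 in ec by ring.
      rewrite e in ec. replace (Cconj 0 * (z0 * C_derive f z0)) with (RtoC 0) in ec.
      * simpl in ec. lra.
      * replace (Cconj 0) with (RtoC 0); [ring|].
        unfold Cconj, RtoC. simpl. f_equal. ring.
Qed.

(** * The first radius at which positivity fails *)

Lemma Re_near (h : C -> C) (z : C) (e : R) :
  taylor 1 h z -> (0 < e)%R -> near z (fun w => (Rabs (Re (h w) - Re (h z)) < e)%R).
Proof.
  intros hh he. generalize (taylor_1_continuous _ _ e hh he). apply near_imp.
  intros w hw. apply Rle_lt_trans with (2 := hw).
  apply Rle_trans with (2 := re_le_Cmod _). right. reflexivity.
Qed.

(** The order of the steps matters: [f] has no zero on the circle, hence p is continuous there,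
    hence Re p >= 0 on the closed disk by radial approach. Were Re p > 0 on all of it, openness and
    compactness would carry positivity beyond the supremum [r]. Definedness is part of the
    conclusion because both the hypothesis of the theorem and the expansions of p require it. *)
Lemma first_boundary_point (f : C -> C) :
  class_A f -> (exists z, unit_disk z /\ (Re (zdlog f z) <= 0)%R) ->
  exists z0, unit_disk z0 /\ z0 <> 0 /\ f z0 <> 0 /\ Re (zdlog f z0) = 0%R /\
    forall z, (Cmod z <= Cmod z0)%R ->
      (z = 0 \/ f z <> 0) /\ (0 <= Re (zdlog f z))%R.
Proof.
  intros hf [zb [hzb bad]]. set (p := zdlog f) in *.
  assert (open : forall z, unit_disk z -> (0 < Re (p z))%R ->
    near z (fun w => (0 < Re (p w))%R)).
  { intros z hz hp.
    generalize (Re_near p z _ (zdlog_taylor f z 1 hf hz (zdlog_defined f z hp)) hp).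
    apply near_imp. intros w hw. apply Rabs_lt_between in hw. lra. }
  destruct (completeness (fun r => forall z, (Cmod z < r)%R -> (0 < Re (p z))%R))
    as [r [hub hlub]].
  - exists (Cmod zb). intros r hr. apply Rnot_lt_le. intros lt.
    specialize (hr zb lt). lra.
  - exists 0%R. intros z hz. pose proof (Cmod_ge_0 z). lra.
  - assert (rb : (r <= Cmod zb)%R).
    { apply hlub. intros s hs. apply Rnot_lt_le. intros lt.
      specialize (hs zb lt). lra. }
    unfold unit_disk in hzb.
    assert (inside : forall z, (Cmod z < r)%R -> (0 < Re (p z))%R).
    { intros z hz. apply NNPP. intros n.
      assert (r <= Cmod z)%R; [|lra]. apply hlub. intros s hs.
      apply Rnot_lt_le. intros lt. apply n, hs, lt. }
    assert (hr : (0 < r)%R).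
    { destruct (open 0) as [d [hd hd']].
      - unfold unit_disk. rewrite Cmod_0. lra.
      - unfold p. rewrite zdlog_0. simpl. lra.
      - apply Rlt_le_trans with (1 := hd). apply hub. intros z hz. apply hd'.
        replace (z - 0) with z by ring. exact hz. }
    assert (def : forall z, (Cmod z <= r)%R -> z = 0 \/ f z <> 0).
    { intros z hz. destruct (Ceq_dec z 0) as [e|nz]; [left; exact e|right].
      apply (nonzero_at_first_boundary f z hf); [unfold unit_disk; lra|exact nz|].
      intros w hw. apply inside. lra. }
    assert (nonneg : forall z, (Cmod z <= r)%R -> (0 <= Re (p z))%R).
    { intros z hz. apply Rnot_lt_le. intros neg.
      assert (hz1 : unit_disk z) by (unfold unit_disk; lra).
      destruct (near_ray z _ (Re_near p z (- Re (p z))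
        (zdlog_taylor f z 1 hf hz1 (def z hz)) ltac:(lra))) as [t [ht hw]].
      assert (0 < Re (p (RtoC t * z)%C))%R.
      { apply inside. rewrite Cmod_mult, Cmod_R, Rabs_pos_eq by lra.
        pose proof (Cmod_ge_0 z). nra. }
      apply Rabs_lt_between in hw. lra. }
    assert (ex : exists z0, (Cmod z0 <= r)%R /\ ~ (0 < Re (p z0))%R).
    { apply NNPP. intros no.
      destruct (disk_compactness r (fun _ w => (0 < Re (p w))%R)) as [d [hd hw]].
      - auto.
      - intros z hz. destruct (open z) as [d [hd hw]].
        + unfold unit_disk; lra.
        + apply NNPP. intros n. apply no. exists z. auto.
        + exists d. auto.
      - assert (r + d <= r)%R; [|lra]. apply hub. exact hw. }
    destruct ex as [z0 [hz0 bz0]].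
    assert (ez0 : Cmod z0 = r).
    { destruct hz0 as [lt|eq]; [|exact eq]. contradiction (bz0 (inside z0 lt)). }
    assert (nz0 : z0 <> 0) by (apply Cmod_gt_0; lra).
    exists z0. split; [unfold unit_disk; lra|]. split; [exact nz0|].
    split; [destruct (def z0 hz0); [contradiction|assumption]|].
    split; [specialize (nonneg z0 hz0); unfold p in *; lra|].
    intros z hz. split; [apply def|apply nonneg]; lra.
Qed.

(** * The power inequality and the conclusion *)

(** As gamma >= 0, [B] may be lowered to A^2/2, which leaves A^(beta + 2 gamma) (1/2)^gamma with A
    >= 1. Both bases are positive, so [rpow] agrees with [Rpower] and the guard on A = 0 is met even
    for negative beta. *)
Lemma pow_bound_lower (A B beta gamma y : R) :
  (0 <= A)%R -> (A ^ 2 = 1 + y ^ 2)%R -> (1 + y ^ 2 <= 2 * B)%R ->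
  (0 <= gamma)%R -> (0 <= beta + 2 * gamma)%R -> ~ pow_bound A B beta gamma.
Proof.
  intros hA eA hB hg hbg [_ hb].
  assert (hA1 : (1 <= A)%R) by (pose proof (pow2_ge_0 y); nra).
  assert (hB0 : (A ^ 2 / 2 <= B)%R) by lra.
  assert (hA2 : (0 < A ^ 2)%R) by (apply pow_lt; lra).
  specialize (hb ltac:(intros _; lra)). apply Rlt_not_le in hb. apply hb.
  unfold rpow. destruct (Req_dec_T A 0); [lra|]. destruct (Req_dec_T B 0); [lra|].
  apply Rle_trans with (Rpower A beta * Rpower (A ^ 2 / 2) gamma)%R.
  - unfold Rpower. rewrite <- exp_plus.
    replace (A ^ 2 / 2)%R with (A * A * (1 / 2))%R by field.
    rewrite !ln_mult by nra.
    assert (0 <= ln A)%R by (rewrite <- ln_1; apply ln_le; lra).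
    assert (le : (gamma * ln (1 / 2)
      <= beta * ln A + gamma * (ln A + ln A + ln (1 / 2)))%R) by nra.
    destruct le as [lt|eq]; [left; apply exp_increasing, lt|].
    right. rewrite eq. reflexivity.
  - apply Rmult_le_compat_l; [left; apply exp_pos|].
    apply Rle_Rpower_l; lra.
Qed.

Theorem theorem2 (f : C -> C) (beta gamma : R)
  (hf : class_A f)
  (hbg : (0 <= beta + 2 * gamma)%R)
  (h : (forall z : C, unit_disk z -> (z = 0 \/ f z <> 0) ->
          pow_bound (Cmod (zdlog f z - 1))
                    (Cmod (z * C_derive (zdlog f) z)) beta gamma)
       \/
       (forall z : C, unit_disk z -> (z = 0 \/ f z <> 0) ->
          pow_bound (Cmod (zdlog f z + 1))
                    (Cmod (z * C_derive (zdlog f) z)) beta gamma)) :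
  starlike f.
Proof.
  assert (hg : (0 <= gamma)%R).
  { assert (h0 : unit_disk 0) by (unfold unit_disk; rewrite Cmod_0; lra).
    apply Rnot_lt_le. intros neg.
    assert (n : Cmod (0 * C_derive (zdlog f) 0) <> 0%R).
    { destruct h as [h|h]; apply (h 0 h0 (or_introl eq_refl)); exact neg. }
    apply n. rewrite Cmult_0_l. exact Cmod_0. }
  split; [exact hf|]. intros z hz. apply NNPP. intros nz.
  destruct (first_boundary_point f hf) as [z0 [hz0 [nz0 [fz0 [re0 hin]]]]].
  { exists z. split; [exact hz|lra]. }
  assert (hd : (2 * Re (z0 * C_derive (zdlog f) z0)
                 <= - (1 + Im (zdlog f z0) ^ 2))%R).
  { apply caratheodory_boundary_derivative.
    - exact nz0.
    - intros w n hw. apply zdlog_taylor; [exact hf| |apply hin; exact hw].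
      unfold unit_disk in *. lra.
    - apply zdlog_0.
    - intros w hw. apply hin. exact hw.
    - exact re0. }
  set (B := Cmod (z0 * C_derive (zdlog f) z0)).
  assert (hB : (1 + Im (zdlog f z0) ^ 2 <= 2 * B)%R).
  { pose proof (re_le_Cmod (z0 * C_derive (zdlog f) z0)) as t. fold B in t.
    apply Rabs_le_between in t. lra. }
  destruct h as [h|h];
    apply (pow_bound_lower _ B beta gamma (Im (zdlog f z0)) (Cmod_ge_0 _)) in h;
    auto; rewrite Cmod2_alt; generalize dependent (zdlog f z0);
    intros w rw; intros; unfold Re, Im in *; simpl; rewrite rw; ring.
Qed.
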